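(* Let $G$ be a connected $n$-dimensional Lie group with unit element $e$, let $f:G\to\mathbb{R}$ be a smooth positive function with $f(e)=1$, and let $\tilde g$ be an $f$-left-invariant Riemannian metric on $G$. Let $\{E_1,\dots,E_n\}$ be left-invariant vector fields on $G$ which form an orthogonal basis at every point of $G$ and an orthonormal basis at $e$ with respect to $\tilde g$, and let $\alpha_{ijk}$ be the structure constants defined by $[E_i,E_j]=\sum_{k=1}^n\alpha_{ijk}E_k$. Let $X=\sum_{i=1}^n\theta^iE_i$ be an arbitrary smooth vector field on $G$ (not necessarily left-invariant, so the $\theta^i$ are smooth functions on $G$), and let $\lambda\in\mathbb{R}$. Then $(G,\tilde g)$ is a Ricci soliton with expansion constant $\lambda$ and vector field $X$ if and only if, for all $p,q=1,\dots,n$, $$\delta_{pq}(Xf)+f(\theta_p^q+\theta_q^p)-\sum_{i=1}^n\theta^if(\alpha_{ipq}+\alpha_{iqp})-2\big(\delta_{pq}\lambda f-\widetilde{\mathrm{Ric}}(E_p,E_q)\big)=0,$$ where $\theta_p^q:=E_p(\theta^q)$ and $\widetilde{\mathrm{Ric}}$ is the Ricci tensor of $\tilde g$.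
   Context: For a smooth positive function $f$ on $G$ with $f(e)=1$, a Riemannian metric $\tilde g$ on $G$ is called $f$-left-invariant if $\tilde g=fg$ for some left-invariant Riemannian metric $g$ on $G$. A Riemannian manifold $(M,g)$ is a Ricci soliton with (smooth) vector field $X$ and expansion constant $\lambda\in\mathbb{R}$ if $\mathcal{L}_Xg=2(\lambda g-\mathrm{Ric}_g)$, where $\mathcal{L}_X$ is the Lie derivative and $\mathrm{Ric}_g$ the Ricci tensor of $g$. Conventions: $R(X,Y)Z=\nabla_X\nabla_YZ-\nabla_Y\nabla_XZ-\nabla_{[X,Y]}Z$ and $\mathrm{Ric}(Y,Z)=\mathrm{tr}(X\mapsto R(X,Y)Z)$. $\delta_{pq}$ is the Kronecker delta. *)

(* Defs.v *)
From HB Require Import structures.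
From mathcomp Require Import all_boot all_order all_algebra.
From mathcomp Require Import all_classical all_reals all_analysis.
From mathcomp Require Import ring.

Set Implicit Arguments.
Unset Strict Implicit.
Unset Printing Implicit Defensive.

Import Order.TTheory GRing.Theory Num.Theory.
Import numFieldNormedType.Exports.

Local Open Scope classical_set_scope.
Local Open Scope ring_scope.

Section SmoothOn.
Context {R : realType}.
Implicit Types V W : normedModType R.

(* Meant for open U and finite-dimensional V and W, where f is of class C^(k+1)
   iff it is differentiable and all its directional derivatives are C^k. *)
Fixpoint Ck_on {V W} (k : nat) (U : set V) (f : V -> W) : Prop :=
  match k with
  | 0 => forall x, U x -> {for x, continuous f}
  | k'.+1 => (forall x, U x -> differentiable f x) /\
             forall v, Ck_on k' U ('D_v f)
  end.

Definition smooth_on {V W} (U : set V) (f : V -> W) : Prop :=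
  forall k, Ck_on k U f.

Lemma Ck_on_local {V W} k (U : set V) (f : V -> W) :
  (forall x, U x -> exists2 A : set V, A x & Ck_on k A f) -> Ck_on k U f.
Proof.
elim: k f => [|k IHk] f H /=.
  by move=> x /H[A Ax]; apply.
split=> [x /H[A Ax []] dA _|v]; first exact: dA.
by apply: IHk => x /H[A Ax [_ /(_ v) ?]]; exists A.
Qed.

Lemma Ck_onS {V W} k (U : set V) (f : V -> W) : Ck_on k.+1 U f -> Ck_on k U f.
Proof.
elim: k f => [|k IHk] f [df Df] /=.
  by move=> x Ux; exact/differentiable_continuous/df.
by split=> // v; exact: IHk.
Qed.

Lemma near_eq_differentiable {V W} (f g : V -> W) x :
  {near x, f =1 g} -> differentiable f x -> differentiable g x.
Proof.
move=> fg df.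
have h0 : g \o shift x = cst (g x) + 'd f x +o_ 0 id.
  have /diff_locallyP[_ fE] := df.
  apply/eqaddoP => e e0; move/eqaddoP: fE => /(_ e e0) fE.
  have fgx : \forall y \near (0 : V), f (y + x) = g (y + x).
    by move: fg; rewrite (near_shift 0 x) subr0.
  near=> y; have fgy : f (y + x) = g (y + x) by near: y.
  rewrite [X in `|X| <= _](_ : _ = (f \o shift x - (cst (f x) + 'd f x)) y).
    by near: y.
  by rewrite !fctE /= fgy (nbhs_singleton fg).
have dg := diff_unique (diff_continuous df) h0.
by apply/diff_locallyP; rewrite dg; split=> //; exact: diff_continuous.
Unshelve. all: by end_near. Qed.

Lemma Ck_on_eq {V W} k (U : set V) (f g : V -> W) : open U ->
  (forall x, U x -> f x = g x) -> Ck_on k U f -> Ck_on k U g.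
Proof.
move=> oU; elim: k f g => [|k IHk] f g fg /=.
  move=> cf x Ux.
  have nfg : {near x, f =1 g}.
    by near do apply: fg; exact: open_nbhs_nbhs.
  rewrite /prop_for /continuous_at -(fg _ Ux).
  exact: (cvg_trans (near_eq_cvg nfg) (cf x Ux)).
have nfg x : U x -> {near x, f =1 g}.
  by move=> Ux; near do apply: fg; exact: open_nbhs_nbhs.
case=> df Df; split=> [x Ux|v].
  exact: near_eq_differentiable (nfg _ Ux) (df _ Ux).
by apply: (IHk ('D_v f)) (Df v) => x Ux; exact/near_eq_derive/nfg.
Unshelve. all: by end_near. Qed.

Lemma Ck_on_sub {V W} k (U A : set V) (f : V -> W) :
  A `<=` U -> Ck_on k U f -> Ck_on k A f.
Proof. by move=> AU fU; apply: Ck_on_local => x /AU Ux; exists U. Qed.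

Lemma Ck_on_cst {V W} k (U : set V) (a : W) : Ck_on k U (cst a : V -> W).
Proof.
elim: k a => [|k IHk] a /=; first by move=> x _; exact: cst_continuous.
split=> // v; rewrite (_ : 'D_v _ = cst 0) //.
by apply/funext => x; rewrite derive_cst.
Qed.

Lemma Ck_onD {V W} k (U : set V) (f g : V -> W) : open U ->
  Ck_on k U f -> Ck_on k U g -> Ck_on k U (f + g).
Proof.
move=> oU; elim: k f g => [|k IHk] f g /=.
  by move=> cf cg x Ux; apply: cvgD; [exact: cf|exact: cg].
move=> [df Df] [dg Dg]; split=> [x Ux|v].
  by apply: differentiableD; [exact: df|exact: dg].
apply: (@Ck_on_eq _ _ _ _ ('D_v f + 'D_v g)) (IHk _ _ (Df v) (Dg v)) => //.
move=> x Ux; rewrite deriveD //; apply: diff_derivable; [exact: df|exact: dg].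
Qed.

Lemma Ck_onM {V} k (U : set V) (f g : V -> R) : open U ->
  Ck_on k U f -> Ck_on k U g -> Ck_on k U (f * g).
Proof.
move=> oU; elim: k f g => [|k IHk] f g /=.
  by move=> cf cg x Ux; apply: cvgM; [exact: cf|exact: cg].
move=> fS gS; have [[df Df] [dg Dg]] := (fS, gS); split=> [x Ux|v].
  by apply: differentiableM; [exact: df|exact: dg].
apply: (@Ck_on_eq _ _ _ _ (f * 'D_v g + g * 'D_v f)) => //.
  move=> x Ux; rewrite deriveM //; apply: diff_derivable; [exact: df|exact: dg].
by apply: Ck_onD => //; apply: IHk => //; exact: Ck_onS.
Qed.

Lemma Ck_on_sum {V W} k (U : set V) n (f : 'I_n -> V -> W) : open U ->
  (forall i, Ck_on k U (f i)) -> Ck_on k U (\sum_(i < n) f i).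
Proof.
move=> oU fU; elim/big_ind: _ => //; first exact: Ck_on_cst.
by move=> g h; exact: Ck_onD.
Qed.

Lemma Ck_on_coord {V} k (U : set V) n (f : V -> 'rV[R]_n) (j : 'I_n) :
  open U -> Ck_on k U f -> Ck_on k U (fun x => f x 0 j).
Proof.
move=> oU; elim: k f => [|k IHk] f /=.
  move=> cf x Ux.
  apply: (@continuous_comp _ _ _ f (fun M : 'rV[R]_n => M 0 j)).
    exact: cf.
  exact: coord_continuous.
move=> [df Df]; split=> [x Ux|v].
  apply: (@differentiable_comp _ _ _ _ f (fun M : 'rV[R]_n => M 0 j)).
    exact: df.
  exact: differentiable_coord.
apply: (@Ck_on_eq _ _ _ _ (fun x => 'D_v f x 0 j)) (IHk _ (Df v)) => // x Ux.
by rewrite derive_mx ?mxE //; exact/diff_derivable/df.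
Qed.

Lemma Ck_on_comp {V} k n (U : set V) (A : set 'rV[R]_n) (f : V -> 'rV[R]_n)
    (g : 'rV[R]_n -> R) : open U -> (forall x, U x -> A (f x)) ->
  Ck_on k U f -> Ck_on k A g -> Ck_on k U (g \o f).
Proof.
move=> oU fUA; elim: k g => [|k IHk] g /=.
  by move=> cf cg x Ux; apply: continuous_comp; [exact: cf|exact/cg/fUA].
move=> fS [dg Dg]; have [df Df] := fS; split=> [x Ux|v].
  by apply: differentiable_comp; [exact: df|exact/dg/fUA].
pose e (j : 'I_n) : 'rV[R]_n := delta_mx 0 j.
apply: (@Ck_on_eq _ _ _ _
  (\sum_(j < n) (fun x => 'D_v f x 0 j) * ('D_(e j) g \o f))) => //; last first.
  apply: Ck_on_sum => // j; apply: Ck_onM => //; first exact: Ck_on_coord.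
  by apply: IHk => //; exact: Ck_onS.
move=> x Ux; have dfx := df _ Ux; have dgx := dg _ (fUA _ Ux).
rewrite fct_sumE [RHS]deriveE; last exact: differentiable_comp.
rewrite diff_comp //= -(deriveE _ dfx) [X in 'd g _ X]row_sum_delta linear_sum.
by apply: eq_bigr => j _; rewrite linearZ /= -deriveE.
Qed.

Lemma Ck_on_slice {V1 V2 W} k (A : set (V1 * V2)) (f : V1 * V2 -> W) (a : V1) :
  Ck_on k A f -> Ck_on k [set x | A (a, x)] (fun x => f (a, x)).
Proof.
have da x : differentiable (pair a : V2 -> V1 * V2) x.
  exact: (@differentiable_pair _ _ _ _ (cst a) id).
elim: k f => [|k IHk] f /=.
  move=> cf x Ax.
  apply: (@continuous_comp _ _ _ (pair a) f); last exact: (cf (a, x)).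
  exact: differentiable_continuous.
move=> [df Df]; split=> [x Ax|v].
  by apply: (@differentiable_comp _ _ _ _ (pair a) f); [|exact: (df (a, x))].
rewrite (_ : 'D_v _ = fun x => 'D_(0, v) f (a, x)); first exact: (IHk _ (Df _)).
apply/funext => x; rewrite /derive.
set F := fun h => _; set G := fun h => _; suff -> : F = G by [].
apply/funext => h; rewrite /F /G /=; congr (_ *: (f _ - _)).
by rewrite -[RHS]/(h *: 0 + a, h *: v + x) scaler0 add0r.
Qed.

End SmoothOn.

Record chart (R : realType) (n : nat) (M : topologicalType) := Chart {
  chart_dom : set M;
  chart_fun :> M -> 'rV[R]_n;
  chart_inv : 'rV[R]_n -> M;
  open_chart_dom : open chart_dom;
  open_chart_cod : open (chart_fun @` chart_dom);
  chart_funK : forall p, chart_dom p -> chart_inv (chart_fun p) = p;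
  chart_fun_continuous : forall p, chart_dom p -> {for p, continuous chart_fun};
  chart_inv_continuous :
    forall x, (chart_fun @` chart_dom) x -> {for x, continuous chart_inv}
}.

(* The atlas need not be maximal: replacing it by the maximal atlas containing
   it changes none of the notions of smoothness below. *)
HB.mixin Record isManifold (R : realType) (n : nat) M of Topological M := {
  atlas : set (chart R n M);
  atlas_cover : forall p : M, exists2 c, atlas c & chart_dom c p;
  atlas_compatible : forall c d, atlas c -> atlas d ->
    smooth_on (c @` (chart_dom c `&` chart_dom d)) (d \o chart_inv c);
  manifold_hausdorff : hausdorff_space M;
  manifold_second_countable : @second_countable M
}.

#[short(type="manifoldType")]
HB.structure Definition Manifold (R : realType) (n : nat) :=
  {M of Topological M & isManifold R n M}.

Definition smooth (R : realType) n (M : manifoldType R n) (h : M -> R) : Prop :=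
  forall c, @atlas R n M c -> smooth_on (c @` chart_dom c) (h \o chart_inv c).

Definition smooth_map (R : realType) m n (M : manifoldType R m)
    (N : manifoldType R n) (F : M -> N) : Prop :=
  continuous F /\
  forall c d, @atlas R m M c -> @atlas R n N d ->
    smooth_on (c @` (chart_dom c `&` F @^-1` chart_dom d))
              (d \o F \o chart_inv c).

(* mulg_smooth is the smoothness of the multiplication as a map G * G -> G, in
   the product charts (c, d) of the manifold G * G. *)
HB.mixin Record isLieGroup (R : realType) (n : nat) G
    of Manifold R n G & Group G := {
  mulg_continuous : continuous (fun z : G * G => (z.1 * z.2)%g);
  mulg_smooth : forall c d k,
    @atlas R n G c -> @atlas R n G d -> @atlas R n G k ->
    smooth_on [set z | [/\ (c @` chart_dom c) z.1, (d @` chart_dom d) z.2 &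
                         chart_dom k (chart_inv c z.1 * chart_inv d z.2)%g]]
      (fun z => k (chart_inv c z.1 * chart_inv d z.2)%g);
  invg_smooth : @smooth_map R n n G G (fun a => a^-1%g)
}.

#[short(type="lieGroupType")]
HB.structure Definition LieGroup (R : realType) (n : nat) :=
  {G of Manifold R n G & Group G & isLieGroup R n G}.

Section ManifoldTheory.
Context {R : realType} {m n : nat} {M : manifoldType R m} {N : manifoldType R n}.

Lemma open_chart_image (c : chart R m M) (A : set M) :
  open A -> open (c @` (chart_dom c `&` A)).
Proof.
move=> oA; rewrite openE => x [p [cp Ap] <-]; rewrite /interior.
have cx : (c @` chart_dom c) (c p) by exists p.
have nA : \forall y \near c p, A (chart_inv c y).
  by apply: (chart_inv_continuous cx); rewrite chart_funK //; exact: open_nbhs_nbhs.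
have nc : nbhs (c p) (c @` chart_dom c).
  by apply: open_nbhs_nbhs; split => //; exact: open_chart_cod.
near=> y; have [q cq qy] : (c @` chart_dom c) y by near: y.
exists q => //; split=> //; rewrite -(chart_funK cq) qy; near: y; exact: nA.
Unshelve. all: by end_near. Qed.

Lemma smoothD (h k : M -> R) : smooth h -> smooth k -> smooth (h + k).
Proof.
by move=> hS kS c Ac i; apply: Ck_onD (hS c Ac i) (kS c Ac i); apply: open_chart_cod.
Qed.

Lemma smoothM (h k : M -> R) : smooth h -> smooth k -> smooth (h * k).
Proof.
by move=> hS kS c Ac i; apply: Ck_onM (hS c Ac i) (kS c Ac i); apply: open_chart_cod.
Qed.

Lemma smooth_cst (a : R) : smooth (cst a : M -> R).
Proof. by move=> c Ac i; exact: Ck_on_cst. Qed.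

Lemma smoothZ (a : R) (h : M -> R) : smooth h -> smooth (a *: h).
Proof. by move=> hS; exact: (smoothM (smooth_cst a) hS). Qed.

Lemma smooth_comp (F : M -> N) (h : N -> R) :
  smooth_map F -> smooth h -> smooth (h \o F).
Proof.
move=> [cF FS] hS c Ac i; apply: Ck_on_local => _ [p cp <-].
have [d Ad dFp] := atlas_cover (F p).
exists (c @` (chart_dom c `&` F @^-1` chart_dom d)); first by exists p.
have oU : open (c @` (chart_dom c `&` F @^-1` chart_dom d)).
  apply: open_chart_image; apply: open_comp; first by move=> q _; exact: cF.
  exact: open_chart_dom.
apply: (Ck_on_eq oU) (Ck_on_comp oU _ (FS c d Ac Ad i) (hS d Ad i)).
  by move=> _ [q [cq dq] <-] /=; rewrite !chart_funK.
by move=> _ [q [cq dq] <-] /=; exists (F q); rewrite ?chart_funK.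
Qed.

End ManifoldTheory.

Lemma smooth_mulg (R : realType) n (G : lieGroupType R n) (a : G) :
  smooth_map (fun p : G => (a * p)%g).
Proof.
have cL : continuous (fun p : G => (a * p)%g).
  move=> p; apply: (@continuous_comp _ _ _ (pair a) (fun z : G * G => (z.1 * z.2)%g)).
    by apply: cvg_pair; [exact: cvg_cst|exact: cvg_id].
  exact: mulg_continuous.
split=> // d k Ad Ak i; have [c Ac ca] := atlas_cover a.
have := @Ck_on_slice _ _ _ _ _ _ _ (c a) (mulg_smooth _ _ _ Ac Ad Ak i).
rewrite /= chart_funK //; apply: Ck_on_sub.
move=> _ [p [dp kp] <-] /=; rewrite chart_funK //.
by split=> //; [exists a|exists p].
Qed.

Section SmoothFun.
Context {R : realType} {n : nat} (M : manifoldType R n).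

Definition smooth_pred : {pred M -> R} := fun h => `[< smooth h >].

Lemma smooth_pred_subring : subring_closed smooth_pred.
Proof.
split=> [|h k /asboolP hS /asboolP kS|h k /asboolP hS /asboolP kS].
- by apply/asboolP; exact: smooth_cst.
- apply/asboolP; rewrite -scaleN1r; exact/smoothD/smoothZ.
- by apply/asboolP; exact: smoothM.
Qed.

Lemma smooth_pred_scale : scaler_closed smooth_pred.
Proof. by move=> a h /asboolP hS; apply/asboolP; exact: smoothZ. Qed.

HB.instance Definition _ :=
  GRing.isSubringClosed.Build (M -> R) smooth_pred smooth_pred_subring.
HB.instance Definition _ :=
  GRing.isScaleClosed.Build R (M -> R) smooth_pred smooth_pred_scale.

Record smoothfun := SmoothFun {
  smoothfun_fun :> M -> R;
  smoothfunP : smoothfun_fun \in smooth_pred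
}.

HB.instance Definition _ := [isSub for smoothfun_fun].
HB.instance Definition _ := [Choice of smoothfun by <:].
HB.instance Definition _ :=
  GRing.SubChoice_isSubComPzRing.Build _ _ smoothfun (GRing.subringClosedP _).
HB.instance Definition _ := [SubZmodule_isSubLmodule of smoothfun by <:].

Lemma smooth_smoothfun (h : smoothfun) : smooth h.
Proof. exact/asboolP/smoothfunP. Qed.

Definition mk_smoothfun (h : M -> R) (hS : smooth h) : smoothfun :=
  SmoothFun (asboolT hS).

End SmoothFun.

(* The tangent space at p is the space of derivations at p of the algebra
   smoothfun M of globally defined smooth functions. *)
Section Tangent.
Context {R : realType} {n : nat} {M : manifoldType R n} (p : M).

Definition derivation_at (v : smoothfun M -> R) : Prop :=
  (forall (a : R) (h k : smoothfun M), v (a *: h + k) = a * v h + v k) /\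
  (forall h k : smoothfun M, v (h * k) = v h * k p + h p * v k).

Definition derivation_pred : {pred smoothfun M -> R} :=
  fun v => `[< derivation_at v >].

Lemma derivation_pred_submod : submod_closed derivation_pred.
Proof.
split=> [|a u v /asboolP[uL uM] /asboolP[vL vM]]; apply/asboolP; split.
- by move=> a h k; rewrite -[LHS]/(0 : R) -[RHS]/(a * 0 + 0 : R) mulr0 addr0.
- by move=> h k; rewrite -[LHS]/(0 : R) -[RHS]/(0 * k p + h p * 0 : R) mul0r mulr0 addr0.
- move=> b h k; have E x : (a *: u + v) x = a * u x + v x by [].
  by rewrite !E uL vL; ring.
- move=> h k; have E x : (a *: u + v) x = a * u x + v x by [].
  by rewrite !E uM vM; ring.
Qed.

HB.instance Definition _ :=
  GRing.isSubmodClosed.Build R (smoothfun M -> R) derivation_pred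
    derivation_pred_submod.

Record tangent := Tangent {
  tangent_fun :> smoothfun M -> R;
  tangentP : tangent_fun \in derivation_pred
}.

HB.instance Definition _ := [isSub for tangent_fun].
HB.instance Definition _ := [Choice of tangent by <:].
HB.instance Definition _ := [SubChoice_isSubLmodule of tangent by <:].

Definition mk_tangent (v : smoothfun M -> R) (hv : derivation_at v) : tangent :=
  Tangent (asboolT hv).

Lemma tangent_derivation (v : tangent) : derivation_at v.
Proof. exact/asboolP/tangentP. Qed.

End Tangent.

Section Pushforward.
Context {R : realType} {m n : nat} {M : manifoldType R m} {N : manifoldType R n}.

Definition smoothfun_comp (F : M -> N) (FS : smooth_map F) (h : smoothfun N) :
  smoothfun M := mk_smoothfun (smooth_comp FS (smooth_smoothfun h)).

Lemma pushforward_subproof F (FS : smooth_map F) (p : M) (v : tangent p) :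
  derivation_at (F p) (fun h => v (smoothfun_comp FS h)).
Proof.
have [vL vM] := tangent_derivation v; split=> [a h k|h k].
  by rewrite -vL; congr (v _); exact/val_inj.
by rewrite (_ : smoothfun_comp _ _ = smoothfun_comp FS h * smoothfun_comp FS k)
  ?vM //; exact/val_inj.
Qed.

Definition pushforward F (FS : smooth_map F) (p : M) (v : tangent p) :
  tangent (F p) := mk_tangent (pushforward_subproof FS v).

End Pushforward.

Section VectorField.
Context {R : realType} {n : nat} (M : manifoldType R n).

(* A field of tangent vectors is smooth iff it maps smooth functions to smooth
   functions. *)
Record vfield := VField {
  vfield_fun :> forall p : M, tangent p;
  vfieldP : forall h : smoothfun M, smooth (fun p => vfield_fun p h)
}.

Lemma vfield_eq (X Y : vfield) : (forall p, X p = Y p) -> X = Y.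
Proof.
case: X Y => [X hX] [Y hY] /= eqXY; have XY : X = Y.
  exact/functional_extensionality_dep.
by subst Y; congr VField; exact: Prop_irrelevance.
Qed.

Definition vapp (X : vfield) (h : smoothfun M) : smoothfun M :=
  mk_smoothfun (vfieldP X h).

Lemma vfield0_subproof (h : smoothfun M) : smooth (fun p : M => (0 : tangent p) h).
Proof. exact: smooth_cst. Qed.
Definition vfield0 := VField vfield0_subproof.

Lemma vfieldD_subproof (X Y : vfield) (h : smoothfun M) : smooth (fun p : M => (X p + Y p) h).
Proof. exact: smoothD (vfieldP X h) (vfieldP Y h). Qed.
Definition vfieldD X Y := VField (vfieldD_subproof X Y).

Lemma vfieldN_subproof (X : vfield) (h : smoothfun M) : smooth (fun p : M => (- X p) h).
Proof.
rewrite (_ : (fun p => _) = -1 *: (vapp X h : M -> R)).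
  exact: smoothZ (vfieldP X h).
by apply/funext => p; rewrite !fctE scaleN1r.
Qed.
Definition vfieldN X := VField (vfieldN_subproof X).

Lemma vfieldZ_subproof (f : smoothfun M) (X : vfield)
    (h : smoothfun M) : smooth (fun p : M => (f p *: X p) h).
Proof. exact: smoothM (smooth_smoothfun f) (vfieldP X h). Qed.
Definition vfieldZ f X := VField (vfieldZ_subproof f X).

HB.instance Definition _ := gen_eqMixin vfield.
HB.instance Definition _ := gen_choiceMixin vfield.

Lemma vfield_addA : associative vfieldD.
Proof. by move=> X Y Z; apply: vfield_eq => p; exact: addrA. Qed.
Lemma vfield_addC : commutative vfieldD.
Proof. by move=> X Y; apply: vfield_eq => p; exact: addrC. Qed.
Lemma vfield_add0 : left_id vfield0 vfieldD.
Proof. by move=> X; apply: vfield_eq => p; exact: add0r. Qed.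
Lemma vfield_addN : left_inverse vfield0 vfieldN vfieldD.
Proof. by move=> X; apply: vfield_eq => p; exact: addNr. Qed.

HB.instance Definition _ :=
  GRing.isZmodule.Build vfield vfield_addA vfield_addC vfield_add0 vfield_addN.

Lemma vfield_scaleA (f g : smoothfun M) X :
  vfieldZ f (vfieldZ g X) = vfieldZ (f * g) X.
Proof. by apply: vfield_eq => p; exact: scalerA. Qed.
Lemma vfield_scale1 : left_id 1 vfieldZ.
Proof. by move=> X; apply: vfield_eq => p; exact: scale1r. Qed.
Lemma vfield_scaleDr : right_distributive vfieldZ +%R.
Proof. by move=> f X Y; apply: vfield_eq => p; exact: scalerDr. Qed.
Lemma vfield_scaleDl X : {morph vfieldZ^~ X : f g / f + g}.
Proof. by move=> f g; apply: vfield_eq => p; exact: scalerDl. Qed.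

HB.instance Definition _ :=
  GRing.Zmodule_isLmodule.Build (smoothfun M) vfield
    vfield_scaleA vfield_scale1 vfield_scaleDr vfield_scaleDl.

Lemma bracket_derivation (X Y : vfield) (p : M) :
  derivation_at p (fun h => X p (vapp Y h) - Y p (vapp X h)).
Proof.
have appL (Z : vfield) a h k : vapp Z (a *: h + k) = a *: vapp Z h + vapp Z k.
  by apply/val_inj/funext => q; have [ZL _] := tangent_derivation (Z q); exact: ZL.
have appM (Z : vfield) h k : vapp Z (h * k) = vapp Z h * k + h * vapp Z k.
  by apply/val_inj/funext => q; have [_ ZM] := tangent_derivation (Z q); exact: ZM.
have [XL XM] := tangent_derivation (X p); have [YL YM] := tangent_derivation (Y p).
have add (v : tangent p) h k : v (h + k) = v h + v k.
  by have [vL _] := tangent_derivation v; rewrite -[h]scale1r vL mul1r scale1r.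
split=> [a h k|h k]; first by rewrite !appL XL YL; ring.
by rewrite !appM !add !XM !YM /=; ring.
Qed.

Lemma bracket_smooth (X Y : vfield) (h : smoothfun M) :
  smooth (fun p => mk_tangent (bracket_derivation X Y p) h).
Proof. exact: smooth_smoothfun (vapp X (vapp Y h) - vapp Y (vapp X h)). Qed.

Definition bracket (X Y : vfield) : vfield := VField (bracket_smooth X Y).

End VectorField.

Definition is_basis (R : realType) (V : lmodType R) n (b : 'I_n -> V) : Prop :=
  forall v, exists! c : 'rV[R]_n, v = \sum_i c 0 i *: b i.

Section Riemannian.
Context {R : realType} {n : nat} (M : manifoldType R n).

(* Smoothness of the tensor field is tested on smooth vector fields. *)
Record riemannian_metric := RiemannianMetric {
  metric_fun :> forall p : M, tangent p -> tangent p -> R;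
  metric_linear : forall p (a : R) (u v w : tangent p),
    metric_fun (a *: u + v) w = a * metric_fun u w + metric_fun v w;
  metric_sym : forall p (u v : tangent p), metric_fun u v = metric_fun v u;
  metric_pos : forall p (u : tangent p), u != 0 -> 0 < metric_fun u u;
  metric_smooth : forall X Y : vfield M, smooth (fun p => metric_fun (X p) (Y p))
}.

Definition metric_app (g : riemannian_metric) (X Y : vfield M) : smoothfun M :=
  mk_smoothfun (metric_smooth g X Y).

Definition is_connection (D : vfield M -> vfield M -> vfield M) : Prop :=
  [/\ forall (f : smoothfun M) X Y Z, D (f *: X + Y) Z = f *: D X Z + D Y Z,
      forall X Y Z, D X (Y + Z) = D X Y + D X Z &
      forall (f : smoothfun M) X Y, D X (f *: Y) = vapp X f *: Y + f *: D X Y].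

Definition is_levi_civita (g : riemannian_metric)
    (D : vfield M -> vfield M -> vfield M) : Prop :=
  [/\ is_connection D,
      forall X Y, D X Y - D Y X = bracket X Y &
      forall X Y Z, vapp X (metric_app g Y Z) =
                    metric_app g (D X Y) Z + metric_app g Y (D X Z)].

(* By the fundamental theorem of Riemannian geometry there is exactly one D
   satisfying is_levi_civita g; the default value of xget is never used. *)
Definition levi_civita (g : riemannian_metric) :
    vfield M -> vfield M -> vfield M :=
  xget (fun _ _ => 0) [set D | is_levi_civita g D].

Definition curvature (D : vfield M -> vfield M -> vfield M) (X Y Z : vfield M) :
    vfield M :=
  D X (D Y Z) - D Y (D X Z) - D (bracket X Y) Z.

(* The trace at p of the endomorphism of the tangent space at p induced by a
   smoothfun M-linear A: by tensoriality, A X p depends only on X p, and every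
   tangent vector at p is the value of a vector field. *)
Definition trace_at (A : vfield M -> vfield M) (p : M) : R :=
  xget 0 [set t | exists (F : 'I_n -> vfield M) (c : 'M[R]_n),
    [/\ is_basis (fun i => F i p),
        forall i, A (F i) p = \sum_j c i j *: F j p & t = \tr c]].

Definition ricci (g : riemannian_metric) (Y Z : vfield M) (p : M) : R :=
  trace_at (fun X => curvature (levi_civita g) X Y Z) p.

(* The Lie derivative L_X g: L_X is the tensor derivation extending
   L_X f = X f and L_X Y = [X, Y]. *)
Definition lie_metric (X : vfield M) (g : riemannian_metric) (Y Z : vfield M) :
    smoothfun M :=
  vapp X (metric_app g Y Z) - metric_app g (bracket X Y) Z
                            - metric_app g Y (bracket X Z).

Definition ricci_soliton (g : riemannian_metric) (X : vfield M) (lambda : R) :=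
  forall (Y Z : vfield M) (p : M),
    lie_metric X g Y Z p = 2 * (lambda * metric_app g Y Z p - ricci g Y Z p).

End Riemannian.

Section LieGroupNotions.
Context {R : realType} {n : nat} (G : lieGroupType R n).

Definition left_invariant_vfield (X : vfield G) : Prop :=
  forall a p : G, pushforward (smooth_mulg a) (X p) = X (a * p)%g.

Definition left_invariant_metric (g : riemannian_metric G) : Prop :=
  forall (a p : G) (u v : tangent p),
    g _ (pushforward (smooth_mulg a) u) (pushforward (smooth_mulg a) v) = g p u v.

Definition f_left_invariant (f : smoothfun G) (gt : riemannian_metric G) : Prop :=
  exists2 g : riemannian_metric G, left_invariant_metric g &
    forall (p : G) (u v : tangent p), gt p u v = f p * g p u v.

End LieGroupNotions.

(* Main.v *)
Require Import Defs.
From mathcomp Require Import all_boot all_order all_algebra.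
From mathcomp Require Import all_classical all_reals all_analysis.
From mathcomp Require Import ring.

(** Both sides of the soliton equation are bilinear tensors, so the
    equation may be tested on the frame [E], where it is a direct computation.

    Left invariance of [E] and of the metric [gt / f] gives
    [gt(E_p, E_q) = delta_pq f] at every point
    ([f_left_invariant_metric_frame]).  The Leibniz rule for the bracket gives
    [[X, E_p] = sum_k (sum_l theta^l alpha_lpk - E_p(theta^k)) E_k]
    ([bracket_frame]), and therefore
    [(L_X gt)(E_p, E_q) = X(delta_pq f) - gt([X, E_p], E_q) - gt(E_p, [X, E_q])]
    is exactly the first three terms of the stated equation
    ([lie_metric_frame]).

    What remains is that the equation on the frame implies the equation for
    all fields ([ricci_soliton_frame]), which rests on two facts.
    - An additive map that pulls out smooth coefficients by their value at [p]
      is determined at [p] by its values on the frame ([tensorial_at_coord]).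
      Since [f * Y = sum_i gt(Y, E_i) E_i] for every vector field [Y], with
      smooth coefficients, this needs no local extension of functions or
      fields.
    - The Ricci tensor is tensorial in both arguments: the curvature of a
      connection is trilinear over the smooth functions, and the trace of a
      linear endomorphism of vector fields can be computed in the frame
      ([trace_at_frame]), hence is linear in the endomorphism. *)

Set Implicit Arguments.
Unset Strict Implicit.
Unset Printing Implicit Defensive.

Import Order.TTheory GRing.Theory Num.Theory.

Local Open Scope classical_set_scope.
Local Open Scope ring_scope.

(** * Tangent vectors and brackets *)

Section Calculus.
Context {R : realType} {n : nat} {M : manifoldType R n}.
Implicit Types (u h k : smoothfun M) (X Y Z W : vfield M) (p : M).

Lemma tangent_ext p (v w : tangent p) : (forall h, v h = w h) -> v = w.
Proof. by move=> vw; apply/val_inj/funext. Qed.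

Lemma tangentD_fun p (v : tangent p) h k : v (h + k) = v h + v k.
Proof.
have [vL _] := tangent_derivation v.
by rewrite -[h]scale1r vL mul1r scale1r.
Qed.

Lemma tangentZ_fun p (v : tangent p) (a : R) h : v (a *: h) = a * v h.
Proof.
have [vL _] := tangent_derivation v.
by apply: (@addIr _ (v 0)); rewrite -tangentD_fun vL.
Qed.

Lemma tangentM_fun p (v : tangent p) h k : v (h * k) = v h * k p + h p * v k.
Proof. by have [_ vM] := tangent_derivation v. Qed.

Lemma vfield_sum (I : Type) (r : seq I) (V : I -> vfield M) p :
  (\sum_(i <- r) V i) p = \sum_(i <- r) V i p.
Proof. by elim/big_rec2: _ => // i _ W _ <-. Qed.

Lemma bracketC X Y p : bracket X Y p = - bracket Y X p.
Proof.
apply: tangent_ext => h.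
by rewrite -[LHS]/(X p (vapp Y h) - Y p (vapp X h))
  -[RHS]/(- (Y p (vapp X h) - X p (vapp Y h))) opprB.
Qed.

Lemma bracket_linear X u Y Z :
  bracket X (u *: Y + Z) = vapp X u *: Y + u *: bracket X Y + bracket X Z.
Proof.
apply: vfield_eq => p; apply: tangent_ext => h.
rewrite -[LHS]/(X p (vapp (u *: Y + Z) h) - (u p * Y p (vapp X h) + Z p (vapp X h))).
have -> : vapp (u *: Y + Z) h = u * vapp Y h + vapp Z h by exact/val_inj.
rewrite tangentD_fun tangentM_fun.
rewrite -[RHS]/(X p u * Y p h + u p * (X p (vapp Y h) - Y p (vapp X h)) +
  (X p (vapp Z h) - Z p (vapp X h))) /=.
ring.
Qed.

Lemma bracket_linearl Z u X Y :
  bracket (u *: X + Y) Z = u *: bracket X Z - vapp Z u *: X + bracket Y Z.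
Proof.
apply: vfield_eq => p; rewrite bracketC bracket_linear.
rewrite -[LHS]/(- (Z p u *: X p + u p *: bracket Z X p + bracket Z Y p)).
rewrite -[RHS]/(u p *: bracket X Z p - Z p u *: X p + bracket Y Z p).
by rewrite (bracketC X Z) (bracketC Y Z) scalerN !opprD [- _ - _]addrC.
Qed.

Lemma bracket0l Z : bracket 0 Z = 0.
Proof.
have := bracket_linearl Z 1 0 0; rewrite !scaler0 addr0 scale1r subr0 => b0.
by apply: (@addIr _ (bracket 0 Z)); rewrite add0r -b0.
Qed.

(** * Tensoriality and traces in a frame *)

Definition fun_linear (A : vfield M -> vfield M) :=
  forall u Y Z, A (u *: Y + Z) = u *: A Y + A Z.

Definition tensorial_at p (V : lmodType R) (L : vfield M -> V) :=
  forall u Y Z, L (u *: Y + Z) = u p *: L Y + L Z.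

(** The factor [u] clears denominators: the coefficients of [Y] itself in the frame
    need not be defined away from [p], while those of [u *: Y] are smooth on all
    of [M]. *)
Definition frame_at p (E : 'I_n -> vfield M) :=
  is_basis (fun i => E i p) /\
  forall Y, exists u (y : 'I_n -> smoothfun M),
    u p != 0 /\ u *: Y = \sum_i y i *: E i.

Lemma basis_coord_inj (V : lmodType R) (b : 'I_n -> V) (c d : 'I_n -> R) :
  is_basis b -> \sum_i c i *: b i = \sum_i d i *: b i -> c =1 d.
Proof.
move=> bb cd i; have [w [_ wU]] := bb (\sum_i c i *: b i).
have Ec : w = \row_i c i by apply: wU; apply: eq_bigr => j _; rewrite mxE.
have Ed : w = \row_i d i by apply: wU; rewrite cd; apply: eq_bigr => j _; rewrite mxE.
by have := congr1 (fun z : 'rV_n => z 0 i) Ed; rewrite Ec !mxE.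
Qed.

Lemma basis_coord (V : lmodType R) (b : 'I_n -> V) : is_basis b ->
  forall v : 'I_n -> V, exists P : 'M[R]_n,
    forall i, v i = \sum_j P i j *: b j.
Proof.
move=> bb v; have /choice[c cE] : forall i, exists c : 'rV[R]_n,
    v i = \sum_j c 0 j *: b j.
  by move=> i; have [c [cE _]] := bb (v i); exists c.
by exists (\matrix_(i, j) c i 0 j) => i; rewrite cE; apply: eq_bigr => j _; rewrite mxE.
Qed.

Lemma tensorial_at_sum p (V : lmodType R) (L : vfield M -> V)
    (y : 'I_n -> smoothfun M) (E : 'I_n -> vfield M) : tensorial_at p L ->
  L (\sum_i y i *: E i) = \sum_i y i p *: L (E i).
Proof.
move=> LL; have L0 : L 0 = 0.
  have := LL 1 0 0; rewrite scaler0 addr0 -[(1 : smoothfun M) p]/(1 : R) scale1r.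
  by move/(congr1 (fun z => z - L 0)); rewrite subrr addrK.
by elim/big_rec2: _ => // i w W _ <-.
Qed.

(** Expanding [u *: Y] over the frame gives [u p *: L Y] as a combination of the
    [L (E i)]; the coefficients are [u p * c i] because the frame is a basis at
    [p], and [u p] cancels. *)
Lemma tensorial_at_coord p (V : lmodType R) (L : vfield M -> V)
    (E : 'I_n -> vfield M) Y (c : 'I_n -> R) : tensorial_at p L -> frame_at p E ->
  Y p = \sum_i c i *: E i p -> L Y = \sum_i c i *: L (E i).
Proof.
move=> LL [bE sE] Yc; have [u [y [up0 uY]]] := sE Y.
have yc : (fun i => u p * c i) =1 (fun i => y i p).
  apply: (basis_coord_inj bE).
  transitivity ((u *: Y) p); last by rewrite uY vfield_sum.
  rewrite -[RHS]/(u p *: Y p) Yc scaler_sumr.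
  by apply: eq_bigr => i _; rewrite scalerA.
have LuY : u p *: L Y = \sum_i y i p *: L (E i).
  rewrite -tensorial_at_sum // -uY -[u *: Y]addr0 LL.
  have := tensorial_at_sum (fun=> 0) E LL.
  rewrite big1 => [->|i _]; last by rewrite scale0r.
  by rewrite big1 ?addr0 // => i _; rewrite -[(0 : smoothfun M) p]/(0 : R) scale0r.
apply: (scalerI up0); rewrite LuY scaler_sumr.
by apply: eq_bigr => i _; rewrite scalerA -yc.
Qed.

Lemma fun_linear_tensorial p A : fun_linear A -> tensorial_at p (fun Y => A Y p).
Proof. by move=> AL u Y Z; rewrite AL. Qed.

(** The values at [p] of any two families used to compute the trace differ by
    an invertible matrix [P]; tensoriality of [A] makes the matrices of [A]
    conjugate by [P], so all candidate traces agree. *)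
Lemma trace_at_frame p (E : 'I_n -> vfield M) A (c : 'M[R]_n) :
    fun_linear A -> frame_at p E ->
  (forall i, A (E i) p = \sum_j c i j *: E j p) -> trace_at A p = \tr c.
Proof.
move=> AL fE Ac; have [bE _] := fE.
rewrite /trace_at (xget_unique _ (x := \tr c)) // => [|_ [F [d [bF Ad ->]]]].
  by exists E, c.
have [P FE] := basis_coord bE (fun i => F i p).
have [Q EF] := basis_coord bF (fun i => E i p).
have comb (B C : 'M[R]_n) (K : 'I_n -> vfield M) i :
    \sum_j B i j *: (\sum_k C j k *: K k p) = \sum_k (B *m C) i k *: K k p.
  under eq_bigr => j _ do rewrite scaler_sumr.
  rewrite exchange_big; apply: eq_bigr => k _; rewrite mxE scaler_suml.
  by apply: eq_bigr => j _; rewrite scalerA.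
have PQ : P *m Q = 1%:M.
  apply/matrixP => i; apply: (basis_coord_inj bF); rewrite -comb.
  under eq_bigr => j _ do rewrite -EF.
  rewrite -FE (bigD1 i) //= big1 ?addr0 => [|j ji]; first by rewrite mxE eqxx scale1r.
  by rewrite mxE eq_sym (negbTE ji) scale0r.
have dP : d *m P = P *m c.
  apply/matrixP => i; apply: (basis_coord_inj bE); rewrite -!comb.
  under eq_bigr => j _ do rewrite -FE.
  under [RHS]eq_bigr => j _ do rewrite -Ac.
  rewrite -Ad; exact: (tensorial_at_coord (fun_linear_tensorial p AL) fE (FE i)).
by rewrite -[d]mulmx1 -PQ mulmxA dP mxtrace_mulC mulmxA (mulmx1C PQ) mul1mx.
Qed.

Lemma trace_at_linear p (E : 'I_n -> vfield M) (a : R) A B C :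
    frame_at p E -> fun_linear A -> fun_linear B -> fun_linear C ->
    (forall X, A X p = a *: B X p + C X p) ->
  trace_at A p = a * trace_at B p + trace_at C p.
Proof.
move=> fE AL BL CL ABC; have [bE _] := fE.
have [b Bb] := basis_coord bE (fun i => B (E i) p).
have [c Cc] := basis_coord bE (fun i => C (E i) p).
rewrite (trace_at_frame BL fE Bb) (trace_at_frame CL fE Cc).
rewrite (@trace_at_frame p E A (a *: b + c)) //; first by rewrite mxtraceD mxtraceZ.
move=> i; rewrite ABC Bb Cc scaler_sumr -big_split; apply: eq_bigr => j _ /=.
by rewrite !mxE scalerDl scalerA.
Qed.

(** * Tensoriality of the curvature and of the Ricci tensor *)

Section Curvature.
Context (D : vfield M -> vfield M -> vfield M) (DC : is_connection D).

Lemma connectionDl X Y Z : D (X + Y) Z = D X Z + D Y Z.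
Proof. by have [DL _ _] := DC; rewrite -[X]scale1r DL !scale1r. Qed.

Lemma connectionDr X Y Z : D X (Y + Z) = D X Y + D X Z.
Proof. by have [_ DA _] := DC. Qed.

Lemma connectionNl X Z : D (- X) Z = - D X Z.
Proof.
have D0 : D 0 Z = 0.
  by apply: (@addIr _ (D 0 Z)); rewrite -connectionDl !add0r.
by apply/eqP; rewrite -addr_eq0 -connectionDl addNr D0.
Qed.

Lemma connectionZl u X Z : D (u *: X) Z = u *: D X Z.
Proof.
have [DL _ _] := DC; apply: (@addIr _ (D 0 Z)).
by rewrite -DL -connectionDl.
Qed.

Lemma connectionZr u X Y : D X (u *: Y) = vapp X u *: Y + u *: D X Y.
Proof. by have [_ _ DM] := DC. Qed.

(** The derivative of [u] produced by [D Y (u *: D X Z)] is cancelled by the one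
    in [bracket (u *: X) Y]. *)
Lemma curvature_linear1 u X X' Y Z :
  curvature D (u *: X + X') Y Z = u *: curvature D X Y Z + curvature D X' Y Z.
Proof.
rewrite /curvature bracket_linearl.
rewrite !(connectionDl, connectionDr, connectionNl, connectionZl, connectionZr).
apply: vfield_eq => p; apply: tangent_ext => h.
have E (V W : vfield M) : (V + W) p h = V p h + W p h by [].
have EN (V : vfield M) : (- V) p h = - V p h by [].
have EZ v (V : vfield M) : (v *: V) p h = v p * V p h by [].
rewrite !(E, EN, EZ); ring.
Qed.

Lemma curvatureC X Y Z : curvature D X Y Z = - curvature D Y X Z.
Proof.
rewrite /curvature; have -> : bracket X Y = - bracket Y X.
  by apply: vfield_eq => p; rewrite bracketC.
by rewrite connectionNl opprK !opprB addrC.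
Qed.

Lemma curvature_linear2 u X Y Y' Z :
  curvature D X (u *: Y + Y') Z = u *: curvature D X Y Z + curvature D X Y' Z.
Proof. by rewrite curvatureC curvature_linear1 opprD -scalerN -!curvatureC. Qed.

(** The first derivatives of [u] cancel between the two orders of covariant
    differentiation; the second derivatives leave the commutator of [X] and [Y]
    applied to [u], which is what [D (bracket X Y) (u *: Z)] contributes. *)
Lemma curvature_linear3 u X Y Z Z' :
  curvature D X Y (u *: Z + Z') = u *: curvature D X Y Z + curvature D X Y Z'.
Proof.
rewrite /curvature.
rewrite !(connectionDl, connectionDr, connectionNl, connectionZl, connectionZr).
apply: vfield_eq => p; apply: tangent_ext => h.
have E (V W : vfield M) : (V + W) p h = V p h + W p h by [].
have EN (V : vfield M) : (- V) p h = - V p h by [].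
have EZ v (V : vfield M) : (v *: V) p h = v p * V p h by [].
rewrite !(E, EN, EZ).
have -> : vapp (bracket X Y) u p =
    vapp X (vapp Y u) p - vapp Y (vapp X u) p by [].
ring.
Qed.

End Curvature.

(** In both cases the curvature is trilinear over the smooth functions, and this
    is all that the tensoriality of the Ricci tensor relies on. *)
Lemma levi_civita_cases (g : riemannian_metric M) :
  is_connection (levi_civita g) \/ levi_civita g = fun _ _ => 0.
Proof. by rewrite /levi_civita; case: xgetP => [D _ []|_]; [left|right]. Qed.

Lemma curvature0 X Y Z : curvature (fun _ _ : vfield M => 0) X Y Z = 0.
Proof. by rewrite /curvature !subr0. Qed.

Section Ricci.
Context (g : riemannian_metric M) (p : M) (E : 'I_n -> vfield M).
Context (frameE : frame_at p E).

Lemma levi_civita_curvature_linear1 Y Z :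
  fun_linear (fun X => curvature (levi_civita g) X Y Z).
Proof.
move=> u X X'; have [DC|->] := levi_civita_cases g.
  exact: curvature_linear1.
by rewrite !curvature0 scaler0 addr0.
Qed.

Lemma ricci_tensoriall Z : tensorial_at p (fun Y => ricci g Y Z p : R^o).
Proof.
move=> u Y Y'; apply: (trace_at_linear frameE) => [|||X];
  try exact: levi_civita_curvature_linear1.
have [DC|->] := levi_civita_cases g; first by rewrite curvature_linear2.
by rewrite !curvature0 scaler0 addr0.
Qed.

Lemma ricci_tensorialr Y : tensorial_at p (fun Z => ricci g Y Z p : R^o).
Proof.
move=> u Z Z'; apply: (trace_at_linear frameE) => [|||X];
  try exact: levi_civita_curvature_linear1.
have [DC|->] := levi_civita_cases g; first by rewrite curvature_linear3.
by rewrite !curvature0 scaler0 addr0.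
Qed.

End Ricci.

(** * The soliton equation in a frame *)

Section Metric.
Context (g : riemannian_metric M).

Lemma metric_suml p (c : 'I_n -> R) (v : 'I_n -> tangent p) w :
  g p (\sum_i c i *: v i) w = \sum_i c i * g p (v i) w.
Proof.
have g0 : g p 0 w = 0.
  have := metric_linear g 1 0 0 w; rewrite scale1r addr0 mul1r.
  by move/(congr1 (fun z => z - g p 0 w)); rewrite subrr addrK.
by elim/big_rec2: _ => // i y x _ <-; rewrite metric_linear.
Qed.

Lemma metric_appC Y Z : metric_app g Y Z = metric_app g Z Y.
Proof. by apply/val_inj/funext => p; exact: Defs.metric_sym. Qed.

Lemma lie_metricE X Y Z p : lie_metric X g Y Z p =
  X p (metric_app g Y Z) - g p (bracket X Y p) (Z p) - g p (Y p) (bracket X Z p).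
Proof. by []. Qed.

Lemma lie_metricC X Y Z : lie_metric X g Y Z = lie_metric X g Z Y.
Proof.
rewrite /lie_metric (metric_appC Z Y) (metric_appC Z (bracket _ _)).
by rewrite (metric_appC Y (bracket _ _)) addrAC.
Qed.

(** The term [X(u) g(Y, Z)] arises once from differentiating [u * g(Y, Z)] and once
    from [bracket X (u *: Y)], with opposite signs. *)
Lemma lie_metric_tensorial X Z p :
  tensorial_at p (fun Y => lie_metric X g Y Z p : R^o).
Proof.
move=> u Y Y'; rewrite -[RHS]/(u p * lie_metric X g Y Z p + lie_metric X g Y' Z p).
rewrite !lie_metricE.
have -> : metric_app g (u *: Y + Y') Z = u * metric_app g Y Z + metric_app g Y' Z.
  by apply/val_inj/funext => q; exact: metric_linear.
rewrite bracket_linear tangentD_fun tangentM_fun.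
rewrite -[(vapp X u *: Y + _ + _) p]/(X p u *: Y p + u p *: bracket X Y p + bracket X Y' p).
rewrite -[(u *: Y + Y') p]/(u p *: Y p + Y' p) -(addrA (X p u *: Y p)) !metric_linear.
rewrite -[metric_app g Y Z p]/(g p (Y p) (Z p)).
ring.
Qed.

Definition soliton_defect X (lambda : R) Y Z p : R :=
  lie_metric X g Y Z p - 2 * (lambda * metric_app g Y Z p - ricci g Y Z p).

Lemma soliton_defect_tensoriall X lambda Z p E : frame_at p E ->
  tensorial_at p (fun Y => soliton_defect X lambda Y Z p : R^o).
Proof.
move=> fE u Y Y'; rewrite /soliton_defect (lie_metric_tensorial X Z).
rewrite (ricci_tensoriall g fE Z).
rewrite -[metric_app g (u *: Y + Y') Z p]/(g p (u p *: Y p + Y' p) (Z p)) metric_linear.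
rewrite -![_ *: (_ : R^o)]/(_ * _) /=; ring.
Qed.

Lemma soliton_defect_tensorialr X lambda Y p E : frame_at p E ->
  tensorial_at p (fun Z => soliton_defect X lambda Y Z p : R^o).
Proof.
move=> fE u Z Z'; rewrite /soliton_defect ![lie_metric X g Y _]lie_metricC.
rewrite (lie_metric_tensorial X Y) (ricci_tensorialr g fE Y) ![metric_app g Y _]metric_appC.
rewrite -[metric_app g (u *: Z + Z') Y p]/(g p (u p *: Z p + Z' p) (Y p)) metric_linear.
rewrite -![_ *: (_ : R^o)]/(_ * _) /=; ring.
Qed.

Lemma ricci_soliton_frame X lambda (E : 'I_n -> vfield M) :
    (forall p, frame_at p E) ->
  ricci_soliton g X lambda <->
  forall i j p, soliton_defect X lambda (E i) (E j) p = 0.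
Proof.
move=> fE; split=> [sol i j p|sol Y Z p].
  by rewrite /soliton_defect sol subrr.
apply/eqP; rewrite -subr_eq0; apply/eqP; rewrite -/(soliton_defect X lambda Y Z p).
have [bE _] := fE p.
have [c [Yc _]] := bE (Y p); have [d [Zd _]] := bE (Z p).
rewrite (tensorial_at_coord (soliton_defect_tensoriall X lambda Z (fE p)) (fE p) Yc).
rewrite big1 // => i _.
rewrite (tensorial_at_coord (soliton_defect_tensorialr X lambda (E i) (fE p)) (fE p) Zd).
by rewrite big1 ?scaler0 // => j _; rewrite sol scaler0.
Qed.

Section ConformalFrame.
Context (E : 'I_n -> vfield M) (f : smoothfun M).
Context (gE : forall i j p, g p (E i p) (E j p) = (i == j)%:R * f p).

Lemma metric_coord p (c : 'I_n -> R) j :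
  g p (\sum_i c i *: E i p) (E j p) = c j * f p.
Proof.
rewrite metric_suml (bigD1 j) //= big1 => [|i ij]; first by rewrite gE eqxx mul1r addr0.
by rewrite gE (negbTE ij) mul0r mulr0.
Qed.

(** The coefficients of [f *: Y] are the inner products [g(Y, E i)], which are
    smooth because the metric is. *)
Lemma conformal_frame_at p : (forall q, is_basis (fun i => E i q)) ->
  f p != 0 -> frame_at p E.
Proof.
move=> bE fp; split=> // Y; exists f, (fun i => metric_app g Y (E i)); split=> //.
apply: vfield_eq => q; rewrite vfield_sum.
have [c [Yc _]] := bE q (Y q).
rewrite -[LHS]/(f q *: Y q) Yc scaler_sumr; apply: eq_bigr => i _.
rewrite -[RHS]/(g q (Y q) (E i q) *: E i q) Yc metric_coord scalerA.
by rewrite mulrC.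
Qed.

Context (alpha : 'I_n -> 'I_n -> 'I_n -> R).
Context (bracketE : forall i j p,
  bracket (E i) (E j) p = \sum_k alpha i j k *: E k p).

Lemma bracket_frame (theta : 'I_n -> smoothfun M) i p :
  bracket (\sum_k theta k *: E k) (E i) p =
  \sum_k (\sum_l theta l p * alpha l i k - E i p (theta k)) *: E k p.
Proof.
transitivity (\sum_l (theta l p *: bracket (E l) (E i) p - E i p (theta l) *: E l p)).
  elim/big_rec2: _ => [|l w W _ IH]; first by rewrite bracket0l.
  by rewrite bracket_linearl -IH.
rewrite sumrB.
under eq_bigr => l _ do rewrite bracketE scaler_sumr.
rewrite exchange_big -sumrB; apply: eq_bigr => k _ /=.
rewrite scalerBl scaler_suml; congr (_ - _).
by apply: eq_bigr => l _; rewrite scalerA.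
Qed.

Lemma lie_metric_frame (theta : 'I_n -> smoothfun M) X i j p :
    X = \sum_k theta k *: E k ->
  lie_metric X g (E i) (E j) p =
  (i == j)%:R * X p f + f p * (E i p (theta j) + E j p (theta i))
  - \sum_k theta k p * f p * (alpha k i j + alpha k j i).
Proof.
move=> Xtheta; rewrite lie_metricE.
have -> : metric_app g (E i) (E j) = (i == j)%:R *: f.
  by apply/val_inj/funext => q; exact: gE.
rewrite (Defs.metric_sym g (E i p)) {2 3}Xtheta !bracket_frame !metric_coord.
rewrite tangentZ_fun.
have -> : \sum_k theta k p * f p * (alpha k i j + alpha k j i) =
    f p * (\sum_k theta k p * alpha k i j + \sum_k theta k p * alpha k j i).
  by rewrite -big_split mulr_sumr; apply: eq_bigr => k _ /=; ring.
ring.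
Qed.

End ConformalFrame.
End Metric.

End Calculus.

(** * Left-invariant fields on a Lie group *)

Lemma f_left_invariant_metric_frame (R : realType) n (G : lieGroupType R n)
    (f : smoothfun G) (gt : riemannian_metric G) (X Y : vfield G) (x : G) :
    f 1%g = 1 -> f_left_invariant f gt ->
    left_invariant_vfield X -> left_invariant_vfield Y ->
  gt x (X x) (Y x) = gt 1%g (X 1%g) (Y 1%g) * f x.
Proof.
move=> f1 [g gL gtE] XL YL; rewrite !gtE f1 mul1r mulrC; congr (_ * _).
by rewrite -[x]mulg1 -XL -YL gL.
Qed.

(** * Ricci solitons on Lie groups with f-left-invariant metrics *)

Theorem corollary2p14 (R : realType) (n : nat) (G : lieGroupType R n)
  (G_connected : connected [set: G])
  (f : smoothfun G) (f_gt0 : forall x : G, 0 < f x) (f_unit : f 1%g = 1)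
  (gt : riemannian_metric G) (gt_fli : f_left_invariant f gt)
  (E : 'I_n -> vfield G)
  (E_left : forall i, left_invariant_vfield (E i))
  (E_basis : forall x : G, is_basis (fun i => E i x))
  (E_orthogonal : forall (x : G) (i j : 'I_n),
     i != j -> gt x (E i x) (E j x) = 0)
  (E_orthonormal : forall i j : 'I_n,
     gt 1%g (E i 1%g) (E j 1%g) = (i == j)%:R)
  (alpha : 'I_n -> 'I_n -> 'I_n -> R)
  (E_bracket : forall (i j : 'I_n) (x : G),
     bracket (E i) (E j) x = \sum_(k < n) alpha i j k *: E k x)
  (theta : 'I_n -> smoothfun G) (X : vfield G)
  (X_theta : X = \sum_(i < n) theta i *: E i)
  (lambda : R) :
  ricci_soliton gt X lambda <->
  forall (p q : 'I_n) (x : G),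
    (p == q)%:R * X x f
    + f x * (E p x (theta q) + E q x (theta p))
    - \sum_(i < n) theta i x * f x * (alpha i p q + alpha i q p)
    - 2 * ((p == q)%:R * lambda * f x - ricci gt (E p) (E q) x) = 0.

Proof.
have gE i j x : gt x (E i x) (E j x) = (i == j)%:R * f x.
  by rewrite (f_left_invariant_metric_frame x f_unit gt_fli) // E_orthonormal.
have frameE x : frame_at x E.
  by apply: (conformal_frame_at gE) => //; rewrite gt_eqF.
rewrite (ricci_soliton_frame gt X lambda frameE).
split=> H p q x; rewrite -[RHS](H p q x) /soliton_defect
  (lie_metric_frame gE E_bracket p q x X_theta)
  -[metric_app gt _ _ x]/(gt x (E p x) (E q x)) gE; ring.
Qed.
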